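(* Let $L$ be a finite geometric modular lattice with height function $h$, induced metric $d=d_h$, and greatest element $I$. If $a,b,c\in L$ are such that the sub-lattice of $L$ generated by $a,b,c$ is isomorphic to $M_3$, then there exists $w\in L$ with $h(w)=h(I)-1$ such that $d(a\wedge w,\,b\wedge w)=d(a,b)-2$.
   Context: All lattices are finite, with greatest element $I$ and least element $O$. The height $h(x)$ of $x\in L$ is the maximum length $l$ of a chain $O=x_0<x_1<\cdots<x_l=x$. A lattice is modular if $a\le c$ implies $a\vee(b\wedge c)=(a\vee b)\wedge c$. A geometric modular lattice is a modular lattice of finite height in which every element is a join of atoms (elements of height 1). In a modular lattice, $d_h(a,b):=h(a\vee b)-h(a\wedge b)$ is a metric on $L$. $M_3$ is the five-element lattice consisting of a least element, a greatest element, and three pairwise incomparable elements any two of which have join the greatest element and meet the least element (equivalently, the lattice of subspaces of $\mathbb{F}_2^2$). A sub-lattice is a subset closed under $\vee$ and $\wedge$. *)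

(* Defs.v *)
From HB Require Import structures.
From mathcomp Require Import all_boot all_order all_algebra.

Set Implicit Arguments.
Unset Strict Implicit.
Unset Printing Implicit Defensive.

Import Order.TTheory GRing.Theory Num.Theory.

Local Open Scope order_scope.

(* The chain \bot < t_1 < ... < t_n = x has length n. The bound n < #|L| only
   makes the index set finite: a chain in L has at most #|L| elements. *)
Definition height (disp : Order.disp_t) (L : finTBLatticeType disp) (x : L)
  : nat :=
  \max_(n < #|L| | [exists t : n.-tuple L,
                      path <%O \bot t && (last \bot t == x)]) n.

(* The difference is taken in int, so no truncation occurs. *)
Definition hdist (disp : Order.disp_t) (L : finTBLatticeType disp) (a b : L)
  : int :=
  ((height (a `|` b))%:Z - (height (a `&` b))%:Z)%R.

Definition modular (disp : Order.disp_t) (L : latticeType disp) : Prop :=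
  forall a b c : L, a <= c -> a `|` (b `&` c) = (a `|` b) `&` c.

(* \bot is the join of the empty set of atoms. *)
Definition atomistic (disp : Order.disp_t) (L : finTBLatticeType disp)
  : Prop :=
  forall x : L, exists A : {set L},
    (forall p : L, p \in A -> height p = 1%N) /\ x = \join_(p in A) p.

Definition geometric_modular (disp : Order.disp_t)
    (L : finTBLatticeType disp) : Prop :=
  modular L /\ atomistic L.

Definition sublattice (disp : Order.disp_t) (L : finLatticeType disp)
    (S : {set L}) : bool :=
  [forall x in S, forall y in S, (x `|` y \in S) && (x `&` y \in S)].

Definition generated_sublattice (disp : Order.disp_t)
    (L : finLatticeType disp) (A : {set L}) : {set L} :=
  \bigcap_(S : {set L} | sublattice S && (A \subset S)) S.

(* S, with the operations of L, is isomorphic to the lattice T. *)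
Definition sublattice_isomorphic (disp : Order.disp_t)
    (L : finLatticeType disp) (S : {set L})
    (disp' : Order.disp_t) (T : finLatticeType disp') : Prop :=
  exists f : T -> L,
    [/\ injective f,
        f @: [set: T] = S,
        {morph f : x y / x `|` y >-> x `|` y} &
        {morph f : x y / x `&` y >-> x `&` y}].

Inductive M3 : Type := M3bot | M3atom of 'I_3 | M3top.

Definition M3_code (x : M3) : option (option 'I_3) :=
  match x with
  | M3bot => None
  | M3top => Some None
  | M3atom i => Some (Some i)
  end.

Definition M3_decode (o : option (option 'I_3)) : M3 :=
  match o with
  | None => M3bot
  | Some None => M3top
  | Some (Some i) => M3atom i
  end.

Lemma M3_codeK : cancel M3_code M3_decode.
Proof. by case. Qed.

HB.instance Definition _ := Countable.copy M3 (can_type M3_codeK).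
HB.instance Definition _ : isFinite M3 := CanIsFinite M3_codeK.

Fact M3_display : Order.disp_t. Proof. exact: (Order.Disp tt tt). Qed.

Definition M3_le (x y : M3) : bool :=
  match x, y with
  | M3bot, _ | _, M3top => true
  | M3atom i, M3atom j => i == j
  | _, _ => false
  end.

Definition M3_meet (x y : M3) : M3 :=
  match x, y with
  | M3top, z | z, M3top => z
  | M3atom i, M3atom j => if i == j then M3atom i else M3bot
  | _, _ => M3bot
  end.

Definition M3_join (x y : M3) : M3 :=
  match x, y with
  | M3bot, z | z, M3bot => z
  | M3atom i, M3atom j => if i == j then M3atom i else M3top
  | _, _ => M3top
  end.

Fact M3_le_refl : reflexive M3_le.
Proof. by case=> /=. Qed.

Fact M3_le_anti : antisymmetric M3_le.
Proof. by move=> [|i|] [|j|] //= /andP[/eqP->]. Qed.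

Fact M3_le_trans : transitive M3_le.
Proof. by move=> [|j|] [|i|] [|k|] //= /eqP->. Qed.

HB.instance Definition _ :=
  Order.Le_isPOrder.Build M3_display M3 M3_le_refl M3_le_anti M3_le_trans.

Fact M3_le0x (x : M3) : M3bot <= x. Proof. by []. Qed.

Fact M3_lex1 (x : M3) : x <= M3top. Proof. by case: x. Qed.

Fact M3_lexI (x y z : M3) : (x <= M3_meet y z) = (x <= y) && (x <= z).
Proof.
change (M3_le x (M3_meet y z) = M3_le x y && M3_le x z).
case: x y z => [|i|] [|j|] [|k|] //=; rewrite ?andbT ?andbF ?andbb //.
2: by case: eqP.
case: (eqVneq j k) => [->|nejk] /=; first by rewrite andbb.
by case: (eqVneq i j) => [->|//]; rewrite (negbTE nejk).
Qed.

Fact M3_leUx (x y z : M3) : (M3_join x y <= z) = (x <= z) && (y <= z).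
Proof.
change (M3_le (M3_join x y) z = M3_le x z && M3_le y z).
case: x y z => [|i|] [|j|] [|k|] //=; rewrite ?andbT ?andbF ?andbb //.
1,3: by case: eqP.
case: (eqVneq i j) => [->|neij] /=; first by rewrite andbb.
by case: (eqVneq i k) => [<-|//]; rewrite eq_sym (negbTE neij).
Qed.

HB.instance Definition _ := Order.hasBottom.Build M3_display M3 M3_le0x.
HB.instance Definition _ := Order.hasTop.Build M3_display M3 M3_lex1.
HB.instance Definition _ :=
  Order.POrder_isMeetSemilattice.Build M3_display M3 M3_lexI.
HB.instance Definition _ :=
  Order.POrder_isJoinSemilattice.Build M3_display M3 M3_leUx.

(* Main.v *)
(* In M3 the joins a \/ c, b \/ c and a \/ b coincide, and they exceed c. A
   modular atomistic lattice is coatomistic, so some coatom w lies above c but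
   not above a \/ b; such a w is above neither a nor b, but is above
   a /\ b <= c. Hence a /\ w and b /\ w are covered by a and b, and transposing
   these two coverings along modular diamonds gives the coverings
   (a /\ w) \/ (b /\ w) -< a \/ (b /\ w) -< a \/ b, while the meet of a /\ w and
   b /\ w is still a /\ b. *)
Require Import Defs.
From mathcomp Require Import all_boot all_order all_algebra.
From mathcomp Require Import zify.

Set Implicit Arguments.
Unset Strict Implicit.
Unset Printing Implicit Defensive.

Import Order.TTheory.

Local Open Scope order_scope.

Definition covers (disp : Order.disp_t) (L : porderType disp) (x y : L) : Prop :=
  x < y /\ forall z, x < z -> z <= y -> z = y.

(** * Transposed coverings in a modular lattice *)

Section ModularDiamond.
Variables (disp : Order.disp_t) (L : latticeType disp).
Hypothesis modL : modular L.
Implicit Types x y : L.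

(** By modularity, [z] between [y] and the join is recovered as the join of [y] with [x /\ z]. So
    [y < z] forces [x /\ y < x /\ z], and the covering then gives [x /\ z = x]. *)
Lemma covers_meet_join x y : covers (x `&` y) x -> covers y (x `|` y).
Proof.
move=> [ltx cov]; split=> [|z ltyz lezj].
  rewrite lt_neqAle leUr andbT; apply: contraTneq ltx => eqy.
  by rewrite (meet_l (_ : x <= y)) ?ltxx // eqy leUl.
have zE : z = y `|` (x `&` z) by rewrite modL ?(ltW ltyz) // joinC meet_r.
have le_meet : x `&` y <= x `&` z by rewrite leI2 // ltW.
have lt_meet : x `&` y < x `&` z.
  rewrite lt_neqAle le_meet andbT; apply: contraTneq ltyz => eqm.
  by rewrite zE -eqm join_l ?leIr // ltxx.
by rewrite zE (cov _ lt_meet (leIl _ _)) joinC.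
Qed.

(** Dual argument: [z] between [x /\ y] and [x] is recovered as [(z \/ y) /\ x]. *)
Lemma covers_join_meet x y : covers y (x `|` y) -> covers (x `&` y) x.
Proof.
move=> [lty cov]; split=> [|z ltmz lezx].
  rewrite lt_neqAle leIl andbT; apply: contraTneq lty => eqx.
  by rewrite join_r ?ltxx // -eqx leIr.
have zE : z = (z `|` y) `&` x by rewrite -modL // join_l // meetC ltW.
have ltyz : y < z `|` y.
  rewrite lt_neqAle leUr andbT; apply: contraTneq ltmz => eqy.
  by rewrite zE -eqy meetC ltxx.
by rewrite zE (cov _ ltyz) ?leU2 // meetC meet_l // leUl.
Qed.

End ModularDiamond.

(** * Heights, coatoms and distances *)

Section Height.
Variables (disp : Order.disp_t) (L : finTBLatticeType disp).
Implicit Types (x y p w : L) (s : seq L).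

Lemma size_chain_lt_card s : path <%O \bot s -> (size s < #|L|)%N.
Proof.
move=> ps; have : uniq (\bot :: s) by apply: lt_sorted_uniq.
by move=> /card_uniqP/= <-; exact: max_card.
Qed.

Lemma size_chain_le_height s :
  path <%O \bot s -> (size s <= height (last \bot s))%N.
Proof.
move=> ps; have lt_s := size_chain_lt_card ps.
apply: (@leq_bigmax_cond _ _ val (Ordinal lt_s)).
by apply/existsP; exists (in_tuple s); rewrite ps eqxx.
Qed.

Lemma height_chain x :
  exists s, [/\ path <%O \bot s, last \bot s = x & size s = height x].
Proof.
suff [n0 n0P] : exists n : 'I_#|L|,
    [exists t : n.-tuple L, path <%O \bot t && (last \bot t == x)].
  have [|n nP nE] := @eq_bigmax_cond _ [pred n : 'I_#|L| |
    [exists t : n.-tuple L, path <%O \bot t && (last \bot t == x)]] val.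
    by apply/card_gt0P; exists n0.
  have [t /andP[pt /eqP tx]] := existsP nP.
  by exists t; rewrite size_tuple /height nE.
(* The maximum is attained only over a nonempty family; the empty chain or the one-step chain to [x]
   supplies a member. *)
have [s [ps sx]] : exists s, path <%O \bot s /\ last \bot s = x.
  have [->|xn0] := eqVneq x \bot; first by exists [::].
  by exists [:: x]; rewrite /= lt0x xn0.
exists (Ordinal (size_chain_lt_card ps)); apply/existsP; exists (in_tuple s).
by rewrite ps sx eqxx.
Qed.

Lemma height_lt x y : x < y -> (height x < height y)%N.
Proof.
move=> ltxy; have [s [ps sx <-]] := height_chain x.
have := @size_chain_le_height (rcons s y).
by rewrite last_rcons size_rcons rcons_path ps sx; apply.
Qed.

Lemma height_le x y : x <= y -> (height x <= height y)%N.
Proof. by rewrite le_eqVlt => /predU1P[->//|/height_lt/ltnW]. Qed.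

Lemma height1_covers p : height p = 1%N -> covers \bot p.
Proof.
move=> hp; have [s [ps sp]] := height_chain p; rewrite hp.
case: s ps sp => [|q []] //= /andP[lt0q _] qp _; split=> [|z lt0z].
  by rewrite -qp.
rewrite le_eqVlt => /predU1P[//|/height_lt].
by rewrite hp ltnS leqNgt (leq_ltn_trans _ (height_lt lt0z)).
Qed.

Hypothesis modL : modular L.

(** Induction on a longest chain to [y], with [z] its penultimate element. Either [z <= x], or
    [z \/ x = y]; then [z] covers [z /\ x] by transposition, and [z /\ x < x] absorbs the extra
    unit. *)
Lemma height_covers x y : covers x y -> height y = (height x).+1.
Proof.
move=> cov; apply/eqP; rewrite eqn_leq height_lt ?(proj1 cov) // andbT.
have [s [ps sy <-]] := height_chain y.
elim/last_ind: s => [//|s z IHs] in x y cov ps sy *.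
rewrite last_rcons in sy; rewrite {z}sy rcons_path in ps *.
rewrite size_rcons ltnS; case/andP: ps => ps; set z := last _ s => ltzy.
have hz : (size s <= height z)%N := size_chain_le_height ps.
have [lezx|nlezx] := boolP (z <= x); first exact: leq_trans hz (height_le _).
have [ltxy maxy] := cov.
have zxE : z `|` x = y.
  apply: maxy; last by rewrite leUx !ltW.
  by rewrite lt_neqAle leUr andbT; apply: contraNneq nlezx => ->; rewrite leUl.
have covz : covers (z `&` x) z by apply: covers_join_meet; rewrite ?zxE.
apply: leq_trans (IHs _ _ covz ps erefl) _; apply: height_lt.
rewrite lt_neqAle leIr andbT; apply: contraTneq ltzy => eqx.
by rewrite -zxE join_l ?ltxx // -eqx leIl.
Qed.

Hypothesis atomL : atomistic L.

Lemma atom_separation x y :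
  ~~ (x <= y) -> exists p, [/\ covers \bot p, p <= x & ~~ (p <= y)].
Proof.
have [A [hA ->]] := atomL x => nle.
have [/exists_inP[p pA nlep]|] := boolP [exists p in A, ~~ (p <= y)].
  by exists p; split=> //; [exact/height1_covers/hA | exact: joins_sup].
rewrite negb_exists_in => /forall_inP leA; case/negP: nle.
by apply/joinsP => p /leA; rewrite negbK.
Qed.

Lemma atom_covers_join p x : covers \bot p -> ~~ (p <= x) -> covers x (p `|` x).
Proof.
move=> covp nlepx; apply: covers_meet_join => //.
suff -> : p `&` x = \bot by [].
apply/eqP; apply: contraNT nlepx => n0.
by rewrite -(proj2 covp (p `&` x)) ?leIr ?leIl // lt0x.
Qed.

(** Take an atom [p] below [x] but not below [y], and [w] of maximal height among the elements above
    [y] and not above [p]. If [p \/ w] missed an atom [q], maximality would put [p] below [q \/ w];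
    as this covers [w], it would equal [p \/ w], which is not above [q]. *)
Lemma coatom_separation x y :
  ~~ (x <= y) -> exists w, [/\ covers w \top, y <= w & ~~ (x <= w)].
Proof.
move=> /atom_separation[p [covp lepx nlepy]].
pose P := [pred w | (y <= w) && ~~ (p <= w)].
have Py : P y by rewrite /= lexx.
case: (arg_maxnP (@height _ L) Py) => w /andP[leyw nlepw] maxw.
have covw := atom_covers_join covp nlepw.
exists w; split=> //; last by apply: contra nlepw; apply: le_trans.
suff <- : p `|` w = \top by [].
apply/eqP; rewrite -le1x; apply/idPn => /atom_separation[q [covq _ nleq]].
have nleqw : ~~ (q <= w) by apply: contra nleq => /le_trans; apply; apply: leUr.
have covqw := atom_covers_join covq nleqw.
have lepqw : p <= q `|` w.
  apply/idPn => nlep; have := maxw (q `|` w).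
  rewrite /= nlep (le_trans leyw (leUr _ _)) => /(_ isT).
  by rewrite leqNgt height_lt // (proj1 covqw).
case/negP: nleq; rewrite (proj2 covqw _ (proj1 covw)) ?leUl //.
by rewrite leUx lepqw leUr.
Qed.

Lemma hdist_meet_coatom x y w :
  covers w \top -> x `&` y <= w -> ~~ (x <= w) -> ~~ (y <= w) ->
  hdist (x `&` w) (y `&` w) = (hdist x y - 2)%R.
Proof.
move=> [ltw maxw] lexyw nlex nley.
have cov_meet z : ~~ (z <= w) -> covers (z `&` w) z.
  move=> nlez; apply: covers_join_meet => //.
  suff -> : z `|` w = \top by [].
  apply: maxw; rewrite ?lex1 // lt_neqAle leUr andbT.
  by apply: contraNneq nlez => ->; rewrite leUl.
set x' := x `&` w; set y' := y `&` w.
have meetE : x' `&` y' = x `&` y.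
  by rewrite meetACA meetxx meet_l.
have cov1 : covers (x `|` y') (x `|` y).
  have -> : x `|` y = y `|` (x `|` y').
    by rewrite joinCA (join_l (leIl _ _)).
  apply: covers_meet_join => //.
  (* Modularity turns the left side into [y' \/ (x /\ y)], and [x /\ y] lies below [y'] because it
     lies below [w]. *)
  suff -> : y `&` (x `|` y') = y' by exact: cov_meet.
  by rewrite joinC meetC -modL ?leIl // join_l // lexI leIr.
have cov2 : covers (x' `|` y') (x `|` y').
  have -> : x `|` y' = x `|` (x' `|` y') by rewrite joinA (join_l (leIl _ _)).
  apply: covers_meet_join => //.
  suff -> : x `&` (x' `|` y') = x' by exact: cov_meet.
  rewrite meetC -modL ?leIl // join_l // lexI leIr /=.
  exact: le_trans (leIl _ _) (leIr _ _).
(* Each of the two coverings costs the join one unit of height; the meet is unchanged. *)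
rewrite /hdist meetE (height_covers cov1) (height_covers cov2).
lia.
Qed.

End Height.

Lemma generated_M3_atoms (disp : Order.disp_t) (L : finTBLatticeType disp)
    (a b c : L) (f : M3 -> L) :
  injective f -> f @: [set: M3] = generated_sublattice [set a; b; c] ->
  {morph f : x y / x `|` y} -> {morph f : x y / x `&` y} ->
  exists i j k : 'I_3,
    [/\ [/\ a = f (M3atom i), b = f (M3atom j) & c = f (M3atom k)],
        i != j, i != k & j != k].
Proof.
move=> injf imf fU fI.
have genS x : x \in [set a; b; c] -> exists u, x = f u.
  move=> xabc; have : x \in f @: [set: M3].
    by rewrite imf; apply/bigcapP => S /andP[_ /subsetP]; apply.
  by case/imsetP => u _ ->; exists u.
have [u aE] : exists u, a = f u by apply: genS; rewrite !inE eqxx.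
have [v bE] : exists u, b = f u by apply: genS; rewrite !inE eqxx orbT.
have [t cE] : exists u, c = f u by apply: genS; rewrite !inE eqxx orbT.
subst a b c.
(* Deleting an atom of M3 leaves a sublattice, so each atom is a generator. *)
have atoms m : M3atom m \in [:: u; v; t].
  apply/idPn; rewrite !inE !negb_or => /and3P[nu nv nt].
  have : f (M3atom m) \in f @: [set: M3] by rewrite mem_imset ?inE.
  (* If no generator were this atom, the image of its complement would be a sublattice containing
     the generators but not the atom. *)
  rewrite imf => /bigcapP/(_ (f @: [set~ M3atom m])).
  rewrite mem_imset // !inE eqxx => /implyP.
  rewrite implybF => /negP; apply; apply/andP; split; last first.
    apply/subsetP => x; rewrite !inE.
    by case/orP=> [/orP[]|] /eqP->; rewrite mem_imset // !inE eq_sym.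
  apply/forall_inP => _ /imsetP[x xm ->].
  apply/forall_inP => _ /imsetP[y ym ->].
  rewrite -fU -fI !mem_imset // !inE in xm ym *.
  rewrite /Order.join /Order.meet /=.
  case: x y xm ym => [|i|] [|j|] /= xm ym; rewrite ?xm ?ym //.
  by case: ifP => _; rewrite ?xm.
pose T := [seq M3atom m | m <- enum 'I_3].
have uT : uniq T by rewrite map_inj_uniq ?enum_uniq // => i j [].
have sub : {subset T <= [:: u; v; t]} by move=> _ /mapP[m _ ->].
have sz : (size [:: u; v; t] <= size T)%N by rewrite size_map size_enum_ord.
(* Three distinct atoms inside a list of three generators exhaust it, so the generators are atoms
   and pairwise distinct. *)
have [_ memE] := uniq_min_size uT sub sz.
have isatom x : x \in [:: u; v; t] -> exists m, x = M3atom m.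
  by rewrite -memE => /mapP[m _ ->]; exists m.
have := leq_size_uniq uT sub sz; rewrite /= !inE negb_or andbT.
have [i ->] : exists m, u = M3atom m by apply: isatom; rewrite !inE eqxx.
have [j ->] : exists m, v = M3atom m by apply: isatom; rewrite !inE eqxx orbT.
have [k ->] : exists m, t = M3atom m by apply: isatom; rewrite !inE eqxx !orbT.
by move=> /andP[/andP[nij nik] njk]; exists i, j, k.
Qed.

Theorem lemma2 (disp : Order.disp_t) (L : finTBLatticeType disp)
    (a b c : L) :
  geometric_modular L ->
  sublattice_isomorphic (generated_sublattice [set a; b; c]) M3 ->
  exists w : L,
    ((height w)%:Z = (height (\top%O : L))%:Z - 1)%R /\
    (hdist (a `&` w)%O (b `&` w)%O = hdist a b - 2)%R.
Proof.
move=> [modL atomL] [f [injf imf fU fI]].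
have [i [j [k [[-> -> _] nij nik njk]]]] := generated_M3_atoms injf imf fU fI.
have joinE m n : m != n -> f (M3atom m) `|` f (M3atom n) = f M3top.
  by move=> /negPf nmn; rewrite -fU; congr f; rewrite /Order.join /= nmn.
have meetE m n : m != n -> f (M3atom m) `&` f (M3atom n) = f M3bot.
  by move=> /negPf nmn; rewrite -fI; congr f; rewrite /Order.meet /= nmn.
have nle : ~~ (f M3top <= f (M3atom k)).
  by rewrite leEmeet -fI (inj_eq injf).
have [w [covw lew nlew]] := coatom_separation modL atomL nle.
(* Together with the [k]-th atom, which is below [w], such an atom would force the top of the copy
   of [M3] below [w]. *)
have nle_atom m : m != k -> ~~ (f (M3atom m) <= w).
  by move=> nmk; apply: contra nlew => lem; rewrite -(joinE _ _ nmk) leUx lem.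
exists w; split; first by rewrite (height_covers modL covw); lia.
apply: hdist_meet_coatom; rewrite ?nle_atom //.
(* The meet of the first two atoms is also that of the first and third, hence below the third and
   below [w]. *)
by rewrite (meetE _ _ nij) -(meetE _ _ nik) (le_trans (leIr _ _)).
Qed.
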